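(* If $L=L_2(q)=PSL_2(q)$, where $q=p^\alpha\geq 4$ and $p$ is a prime, then the direct square $L\times L$ is unrecognizable by spectrum.
   Context: The spectrum $\omega(G)$ of a finite group $G$ is the set of orders of its elements. Finite groups $G$ and $H$ are isospectral if $\omega(G)=\omega(H)$. A finite group $G$ is unrecognizable by spectrum if there are infinitely many pairwise nonisomorphic finite groups isospectral to $G$. $L_2(q)=PSL_2(q)$ is the $2$-dimensional projective special linear group over the field of order $q$. *)

(* Defs.v *)
From HB Require Import structures.
From mathcomp Require Import all_boot all_order all_algebra.
From mathcomp Require Import all_fingroup all_solvable all_field.

Set Implicit Arguments.
Unset Strict Implicit.
Unset Printing Implicit Defensive.

Import GRing.Theory GroupScope.

Definition spectrum (gT : finGroupType) (G : {group gT}) : pred nat :=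
  fun n => [exists x in G, #[x] == n].

Definition isospectral (gT rT : finGroupType)
    (G : {group gT}) (H : {group rT}) : Prop :=
  spectrum G =i spectrum H.

(* "Infinitely many pairwise nonisomorphic groups" is given by a sequence; its
   terms may live in different ambient group types. *)
Definition unrecognizable (gT : finGroupType) (G : {group gT}) : Prop :=
  exists (rT : nat -> finGroupType) (H : forall i, {group rT i}),
    (forall i, isospectral (H i) G) /\
    (forall i j, i != j -> ~~ (H i \isog H j)).

Definition SL2 (F : finFieldType) : {set {'GL_2[F]}} :=
  [set g | (\det (GLval g) == 1)%R].

Lemma SL2_group_set (F : finFieldType) : group_set (SL2 F).
Proof.
apply/group_setP; split=> [|g h]; rewrite !inE ?GL_1E ?det1 //.
by rewrite GL_MxE det_mulmx => /eqP-> /eqP->; rewrite mulr1.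
Qed.

Canonical SL2_group (F : finFieldType) : {group {'GL_2[F]}} :=
  Group (SL2_group_set F).

Definition PSL2 (F : finFieldType) : {group coset_of 'Z(SL2 F)} :=
  (SL2 F / 'Z(SL2 F))%G.

(* Main.v *)
(* Let [d = gcd(2, q - 1)], [m = (q - 1) / d] and [n = (q + 1) / d]. The spectrum
   of [L] consists of [p] and of the divisors of [m] and of [n], where [m] and
   [n] are coprime. If [K] is a finite group whose spectrum consists of the
   divisors of [m] and of [n], then [L x K] is isospectral to [L x L]: every
   element of the latter has order [lcm(a, b)] with [a], [b] in the spectrum of
   [L], and either one of them divides [m] or [n], or both are [p]. Infinitely
   many such [K] are the Frobenius groups [R^i : <u>] with
   [R = (Z/m)[X]/(Phi_n)] and [u] the class of [X]: since [m] and [n] are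
   coprime, the nontrivial powers of [u] fix only [0]. *)
Require Import Defs.
From HB Require Import structures.
From mathcomp Require Import all_boot all_order all_algebra.
From mathcomp Require Import all_fingroup all_solvable all_field.
From mathcomp Require Import ring.

Set Implicit Arguments.
Unset Strict Implicit.
Unset Printing Implicit Defensive.

Import GRing.Theory.
Local Open Scope ring_scope.

(** * The Frobenius groups [R^(i+1) : <u>] and their element orders *)

Section AffineGroup.

Variables (R : finComNzRingType) (u : R) (n i : nat).
Hypotheses (n_gt0 : (0 < n)%N) (un1 : u ^+ n = 1).
Hypothesis u_free :
  forall k (a : R), ~~ (n %| k)%N -> u ^+ k * a = a -> a = 0.

Implicit Types (k : 'I_n) (v w : 'rV[R]_i.+1).

Let affine_fun k w v := u ^+ k *: v + w.

Lemma affine_fun_inj k w : injective (affine_fun k w).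
Proof.
apply: (can_inj (g := fun v => u ^+ (n - k) *: (v - w))) => v.
by rewrite /affine_fun addrK scalerA -exprD subnK ?un1 ?scale1r // ltnW.
Qed.

(** The semidirect product is realized inside the symmetric group of [R^(i+1)], so that only closure
    has to be checked. The dimension [i.+1] is positive, which makes the powers of [u] act
    faithfully. *)
Definition affine_perm (kw : 'I_n * 'rV[R]_i.+1) : {perm 'rV[R]_i.+1} :=
  perm (@affine_fun_inj kw.1 kw.2).

Lemma affine_permE kw v : affine_perm kw v = u ^+ kw.1 *: v + kw.2.
Proof. exact: permE. Qed.

Definition affine_set := [set affine_perm kw | kw : 'I_n * 'rV[R]_i.+1].

Lemma affine_group_set : group_set affine_set.
Proof.
apply/group_setP; split=> [|_ _ /imsetP[[k w] _ ->] /imsetP[[l z] _ ->]].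
  apply/imsetP; exists (Ordinal n_gt0, 0) => //; apply/permP=> v.
  by rewrite affine_permE perm1 /= expr0 scale1r addr0.
apply/imsetP; exists (Ordinal (ltn_pmod (k + l) n_gt0), u ^+ l *: w + z) => //.
apply/permP=> v; rewrite permM !affine_permE /= (expr_mod _ un1) addnC exprD.
by rewrite scalerDr scalerA addrA.
Qed.

Canonical affine_group := Group affine_group_set.

(** The value at 0 recovers [w], and the value at the all-ones vector then recovers [u ^+ k]. If
    [u ^+ k = u ^+ l] with [l < k < n], then [u ^+ (k - l)] fixes 1, and [u_free] gives [1 = 0]. *)
Lemma affine_perm_inj : injective affine_perm.
Proof.
move=> [k w] [l z] /permP E; move: (E 0).
rewrite !affine_permE /= !scaler0 !add0r => eq_wz; congr (_, _) => //.
move: (E (const_mx 1)); rewrite !affine_permE /= eq_wz => /addIr/rowP/(_ 0).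
rewrite !mxE !mulr1 => eq_u; apply/eqP; rewrite -val_eqE.
have noX (k1 l1 : 'I_n) : u ^+ k1 = u ^+ l1 -> (l1 < k1)%N -> False; last first.
  by case: ltngtP => // /noX[].
move: k1 l1 => {eq_wz E w z k eq_u}k {}l eq_u lt_lk.
have /eqP[]: (1 : R) != 0 by apply: oner_neq0.
apply: (u_free (k := k - l)).
  by rewrite gtnNdvd ?subn_gt0 // (leq_ltn_trans (leq_subr _ _)).
have ul : u ^+ l * u ^+ (n - l) = 1 by rewrite -exprD subnKC ?un1 // ltnW.
by rewrite mulr1 -[LHS]mulr1 -ul mulrA -exprD subnK ?eq_u // ltnW.
Qed.

Lemma card_affine_set : #|affine_set| = (n * #|R| ^ i.+1)%N.
Proof.
by rewrite (card_imset _ affine_perm_inj) card_prod card_ord card_mx mul1n.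
Qed.

Lemma affine_permX kw j v :
  (affine_perm kw ^+ j)%g v =
    u ^+ (kw.1 * j) *: v + (\sum_(t < j) u ^+ (kw.1 * t)) *: kw.2.
Proof.
elim: j => [|j IHj]; first by rewrite expg0 perm1 muln0 scale1r big_ord0 scale0r addr0.
rewrite expgSr permM IHj affine_permE scalerDr !scalerA -exprD mulnS -addrA.
rewrite -[X in _ + (_ + X)]scale1r -scalerDl big_ord_recl /= muln0 expr0 addrC.
rewrite mulr_sumr addrC; congr (_ + _ *: _); rewrite [RHS]addrC; congr (_ + _).
by apply: eq_bigr => t _; rewrite -exprD mulnS.
Qed.

Section Spectrum.

Variable m : nat.
Hypothesis charR : forall j, (j%:R == 0 :> R) = (m %| j)%N.

(** A translation is killed by [m], which is 0 in [R]. If [k != 0], the [n]-th power is the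
    translation by [S *: w], where [S] is the sum of [u ^+ (k * t)] over [t < n]. As
    [(u ^+ k - 1) * S = u ^+ (k * n) - 1 = 0], the element [S] is fixed by [u ^+ k], hence 0. *)
Lemma affine_order_dvd x : x \in affine_set -> (#[x]%g %| m)%N || (#[x]%g %| n)%N.
Proof.
case/imsetP=> kw _ ->; rewrite !order_dvdn; have [k0 | k_neq0] := posnP kw.1.
  apply/orP; left; apply/eqP/permP => v; rewrite affine_permX perm1 k0.
  rewrite mul0n scale1r (eq_bigr (fun=> 1)) ?sumr_const ?card_ord => [|t _].
    by have /eqP-> : m%:R == 0 :> R; rewrite ?charR // scale0r addr0.
  by rewrite mul0n.
apply/orP; right; apply/eqP/permP => v; rewrite affine_permX perm1 mulnC.
rewrite exprM un1 expr1n scale1r (_ : \sum_(t < n) _ = 0) ?scale0r ?addr0 //.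
apply: (u_free (k := kw.1)); first by rewrite gtnNdvd.
apply/eqP; rewrite -subr_eq0 -[X in _ - X]mul1r -mulrBl.
under eq_bigr do rewrite exprM.
by rewrite -subrX1 -exprM mulnC exprM un1 expr1n subrr.
Qed.

Lemma affine_has_order_n : exists2 x, x \in affine_set & (n %| #[x]%g)%N.
Proof.
(* The witness [v |-> u *: v] needs the exponent 1 to be an element of ['I_n]. *)
have [n1|n_neq1] := eqVneq n 1%N; first by exists 1%g; rewrite ?group1 // n1 dvd1n.
have n_gt1: (1 < n)%N by rewrite ltn_neqAle eq_sym n_neq1.
exists (affine_perm (Ordinal n_gt1, 0)); first exact: imset_f.
set x := affine_perm _; have := expg_order x.
move/permP/(_ (const_mx 1)); rewrite affine_permX perm1 /= mul1n scaler0 addr0.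
move/rowP/(_ 0); rewrite !mxE => eq1; apply: contraT => ndv.
by have /eqP := u_free ndv eq1; rewrite oner_eq0.
Qed.

Lemma affine_has_order_m : exists2 x, x \in affine_set & (m %| #[x]%g)%N.
Proof.
exists (affine_perm (Ordinal n_gt0, const_mx 1)); first exact: imset_f.
set x := affine_perm _; have := expg_order x.
move/permP/(_ 0); rewrite affine_permX perm1 /= scaler0 add0r.
move/rowP/(_ 0); rewrite !mxE mulr1 (eq_bigr (fun=> 1)) => [|t _].
  by rewrite sumr_const card_ord => /eqP; rewrite charR.
by rewrite mul0n.
Qed.

End Spectrum.

End AffineGroup.

(** * The ring [(Z/m)[X]/(Phi_n)] and its root of unity *)

(** The sum is [(X^n - 1) / (X^e - 1)], the product of the [Phi_d] with [d] dividing [n] but not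
    [e]. Since [e < n], the factor [Phi_n] is among them, and [q] collects the others. *)
Lemma Cyclotomic_dvd_geometric_sum n e :
  (0 < n)%N -> (e %| n)%N -> (e < n)%N ->
  exists q : {poly int}, 'Phi_n * q = \sum_(i < n %/ e) 'X^(e * i).
Proof.
move=> n_gt0 dv_en lt_en; have e_gt0 := dvdn_gt0 n_gt0 dv_en.
pose r := rem n (divisors n).
have perm_n : perm_eq (divisors n) (n :: r) by rewrite perm_to_rem // -dvdn_divisors.
have uniq_r : uniq r by rewrite rem_uniq ?divisors_uniq.
exists (\prod_(d <- r | ~~ (d %| e)%N) 'Phi_d).
have Xe_neq0 : 'X^e - 1 != 0 :> {poly int} by rewrite -size_poly_gt0 size_XnsubC.
apply: (mulfI Xe_neq0); under [in RHS]eq_bigr do rewrite exprM.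
rewrite -subrX1 -exprM mulnC divnK //.
rewrite -(prod_Cyclotomic n_gt0) (perm_big _ perm_n) big_cons mulrCA; congr (_ * _).
rewrite [RHS](bigID (fun d => d %| e)%N) /=; congr (_ * _).
rewrite -(prod_Cyclotomic e_gt0) -[RHS]big_filter; apply: perm_big.
apply: uniq_perm; rewrite ?filter_uniq ?divisors_uniq // => d.
rewrite mem_filter mem_rem_uniq ?divisors_uniq // inE -!dvdn_divisors //.
case dv_de: (d %| e)%N => //=; rewrite (dvdn_trans dv_de) // andbT.
by rewrite ltn_eqF // (leq_ltn_trans (dvdn_leq _ dv_de)).
Qed.

(** Modulo [m], [Phi_n] stays monic of positive degree, so the constants [Z/m] embed in the quotient
    and its characteristic is exactly [m]. *)
Lemma exists_Cyclotomic_quotient m n : (1 < m)%N -> (0 < n)%N ->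
  exists (R : finComNzRingType) (f : {rmorphism {poly int} -> R}),
    f 'Phi_n = 0 /\ forall j, (j%:R == 0 :> R) = (m %| j)%N.
Proof.
move=> m_gt1 n_gt0.
pose h : {poly 'Z_m} := map_poly intr 'Phi_n.
have h_monic : h \is monic by rewrite monic_map ?Cyclotomic_monic.
have size_h : size h = (totient n).+1.
  by rewrite size_map_poly_id0 ?size_Cyclotomic // (monicP (Cyclotomic_monic n)) oner_neq0.
(* The modulus of [{poly %/ h}] is [mk_monic h], which falls back to ['X] unless [h] is monic and
   nonconstant. *)
have mk_h : mk_monic h = h :> {poly _}.
  by rewrite /mk_monic h_monic size_h ltnS totient_gt0 n_gt0.
pose R : finComNzRingType := HB.pack_for finComNzRingType {poly %/ h}
  (Finite.on {poly %/ h}) (GRing.ComNzRing.on {poly %/ h}).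
pose f : {rmorphism {poly int} -> R} := in_qpoly h \o map_poly intr.
exists R, f; split=> [|j].
  by apply: val_inj; rewrite /= -/h mk_h Pdiv.RingMonic.rmodpp.
rewrite -val_eqE /= qpolyC_natr -polyC_natr polyC_eq0 -val_eqE /=.
by rewrite val_Zp_nat.
Qed.

(** Take for [u] the class of [X]. If [u ^+ k] fixes [a], then by Bezout so does [u ^+ e] with
    [e = gcdn k n < n]. The geometric sum in [X^e] is a multiple of [Phi_n], so it vanishes at [u];
    applied to [a] it gives [a *+ (n %/ e) = 0]. Also [a *+ m = 0], and [m] is coprime to [n %/ e],
    so [a = 0]. *)
Lemma exists_free_root_of_unity m n :
    (1 < m)%N -> (0 < n)%N -> coprime m n ->
  exists (R : finComNzRingType) (u : R),
    [/\ u ^+ n = 1, forall k (a : R), ~~ (n %| k)%N -> u ^+ k * a = a -> a = 0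
      & forall j, (j%:R == 0 :> R) = (m %| j)%N].
Proof.
move=> m_gt1 n_gt0 co_mn.
have [R [f [fPhi charR]]] := exists_Cyclotomic_quotient m_gt1 n_gt0.
have fX k : f 'X^k = (f 'X) ^+ k by rewrite rmorphXn.
have un1 : (f 'X) ^+ n = 1.
  apply/eqP; rewrite -subr_eq0 -fX -(rmorph1 f) -rmorphB -prod_Cyclotomic //.
  by rewrite (big_rem n) /= -?dvdn_divisors // rmorphM fPhi mul0r.
exists R, (f 'X); split=> // k a ndv_nk uka.
have k_gt0 : (0 < k)%N by case: k ndv_nk {uka}; rewrite ?dvdn0.
pose e := gcdn k n.
have lt_en : (e < n)%N.
  rewrite ltn_neqAle dvdn_leq ?dvdn_gcdr // andbT.
  by apply: contra ndv_nk => /eqP <-; apply: dvdn_gcdl.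
have uXa l j : f 'X ^+ l * a = a -> f 'X ^+ (l * j) * a = a.
  move=> ula; elim: j => [|j IHj]; first by rewrite muln0 mul1r.
  by rewrite mulnS exprD -mulrA IHj.
have uea : f 'X ^+ e * a = a.
  have [b c def_e _] := egcdnP n k_gt0.
  have una : f 'X ^+ (n * c) * a = a by apply: uXa; rewrite un1 mul1r.
  by rewrite -{1}una mulrA -exprD addnC mulnC -def_e mulnC uXa.
have [|q /(congr1 f)] := Cyclotomic_dvd_geometric_sum n_gt0 (dvdn_gcdr k n : (e %| n)%N).
  exact: lt_en.
rewrite rmorphM fPhi mul0r rmorph_sum /= => /esym/(congr1 (fun x => x * a)).
rewrite mul0r mulr_suml (eq_bigr (fun=> a)) => [|i _]; last by rewrite fX uXa.
rewrite sumr_const card_ord => ea0.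
have co_m : coprime m (n %/ e).
  by apply: coprime_dvdr co_mn; rewrite dvdn_div ?dvdn_gcdr.
have [b c def_1 _] := egcdnP (n %/ e) (ltnW m_gt1).
have am0 j : a *+ (j * m) = 0.
  by rewrite -mulr_natl natrM (eqP (_ : m%:R == 0)) ?charR // mulr0 mul0r.
have := am0 b; rewrite def_1 (eqP co_m) mulrnDr mulnC mulrnA.
by rewrite -[a *+ _]/(a *+ (n %/ e)) ea0 mul0rn add0r.
Qed.

(** * Two-by-two matrices of determinant 1 and the polynomials [X^2 - t X + 1] *)

Lemma ord2P (i : 'I_2) : i = 0 \/ i = 1.
Proof. by case: i => [[|[|//]] lt_i]; [left | right]; apply: val_inj. Qed.

Lemma sum_ord2 (V : nmodType) (f : 'I_2 -> V) : \sum_i f i = f 0 + f 1.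
Proof. by rewrite big_ord_recl big_ord1; congr (_ + f _); apply: val_inj. Qed.

Lemma det_mx22 (R : comNzRingType) (A : 'M[R]_2) :
  \det A = A 0 0 * A 1 1 - A 0 1 * A 1 0.
Proof.
rewrite (expand_det_row _ 0) big_ord_recl big_ord1 /cofactor !det_mx11 !mxE.
rewrite expr0 expr1 mul1r mulN1r mulrN.
by congr (_ * A _ _ - A _ _ * A _ _); apply: val_inj.
Qed.

Section DetOnePoly.

Variables (F : finFieldType) (p alpha : nat) (t : F).
Hypotheses (p_pr : prime p) (cardF : #|F| = (p ^ alpha)%N).
Let q := #|F|.
Let f := 'X^2 - t *: 'X + 1 : {poly F}.

Let size_f : size f = 3%N.
Proof.
rewrite /f -addrA size_polyDl ?size_polyXn // (leq_ltn_trans (size_polyD _ _)) //.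
by rewrite gtn_max size_poly1 size_polyN (leq_ltn_trans (size_scale_leq _ _)) ?size_polyX.
Qed.

Let pnat_exp e : [pchar {poly F}].-nat (p ^ e)%N.
Proof.
by rewrite pnatX pnatE // pchar_poly (card_finPcharP cardF p_pr).
Qed.

Let q_gt0 : (0 < q)%N. Proof. exact: ltnW (finNzRing_gt1 F). Qed.

(** The roots of [f] are [x] and its inverse. If they differ, both are roots of [X^(q-1) - 1], as
    are all nonzero elements of [F]. If they agree, [f = (X - x)^2] divides
    [(X - x)^p = X^p - x^p]. *)
Lemma dvdp_det1_split x : root f x ->
  f %| 'X^(q.-1) - 1 \/ x ^+ 2 = 1 /\ f %| 'X^p - (x ^+ p)%:P.
Proof.
move=> fx; have x_neq0 : x != 0.
  by apply: contraTneq fx => ->; rewrite /root !hornerE ?(mulr0, expr0n, subr0, add0r) oner_eq0.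
have def_t : t = x + x^-1.
  apply: (mulfI x_neq0); rewrite mulrDr mulfV // mulrC.
  by move: fx; rewrite /root !hornerE -expr2 addrAC subr_eq0 => /eqP<-.
have def_f : f = ('X - x%:P) * ('X - x^-1%:P).
  have xxV : x%:P * (x^-1)%:P = 1 by rewrite -polyCM mulfV.
  rewrite /f def_t -mul_polyC polyCD -xxV; ring.
have [x_id | x_neq] := eqVneq x x^-1; [right | left].
  have x2 : x ^+ 2 = 1 by rewrite expr2 {2}x_id mulfV.
  split=> //; have := exprDn_pchar 'X (- x%:P) (pnat_exp 1).
  rewrite exprNn_pchar // -polyC_exp expn1 => <-.
  by rewrite def_f -x_id -expr2 dvdp_exp2l ?prime_gt1.
have := @uniq_roots_dvdp _ ('X^(q.-1) - 1) [:: x; x^-1].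
rewrite uniq_rootsE /= inE x_neq /= !big_cons big_nil mulr1 def_f => -> //.
have rt (y : F) : y != 0 -> root ('X^(q.-1) - 1) y.
  move=> y_neq0; rewrite /root !hornerE subr_eq0 -(inj_eq (mulfI y_neq0)).
  by rewrite -exprS prednK // mulr1 expf_card.
by rewrite !rt ?invr_eq0.
Qed.

(** Without a root in [F], [f] is irreducible; its roots are exchanged by the [q]-th power map and
    have product 1, so they satisfy [z^(q+1) = 1]. The argument is carried out inside [F[X]]: [f]
    divides [(X^q - X)(X^(q+1) - 1)], hence one of the two factors. *)
Lemma dvdp_det1 :
  [\/ f %| 'X^(q.-1) - 1, f %| 'X^(q.+1) - 1 |
      exists2 x : F, x ^+ 2 = 1 & f %| 'X^p - (x ^+ p)%:P].
Proof.
have [/existsP[x fx] | /existsPn no_root] := boolP [exists x, root f x].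
  by case: (dvdp_det1_split fx) => [|[]]; [constructor 1 | constructor 3; exists x].
have irr_f : irreducible_poly f by apply: cubic_irreducible; rewrite ?size_f.
(* This holds because [f ^+ q] is [f] evaluated at ['X^q]. *)
have key : ('X^q - 'X) * ('X^(q.+1) - 1) = 'X * f ^+ q - 'X^q * f.
  have pnat_q : [pchar {poly F}].-nat q by rewrite /q cardF.
  have tq : t ^+ q = t := expf_card t.
  rewrite /f addrAC exprDn_pchar // exprDn_pchar // exprNn_pchar // exprZn tq.
  by rewrite expr1n -!mul_polyC -exprM mulnC exprM exprS; ring.
have dv_prod : f %| ('X^q - 'X) * ('X^(q.+1) - 1).
  by rewrite key dvdp_sub // dvdp_mull // dvdp_exp.
(* The first case need not be refuted: [f] is coprime to ['X], so it yields the first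
   alternative. *)
have [dv | ndv] := boolP (f %| 'X^q - 'X); [constructor 1 | constructor 2].
  move: dv; have -> : 'X^q - 'X = 'X * ('X^(q.-1) - 1) :> {poly F}.
    by rewrite mulrBr mulr1 -exprS prednK.
  rewrite Gauss_dvdpr // irreducible_poly_coprime //.
  by apply/negP => /dvdp_leq; rewrite polyX_eq0 size_f size_polyX => /(_ isT).
by move: dv_prod; rewrite Gauss_dvdpr // irreducible_poly_coprime.
Qed.

End DetOnePoly.

Lemma char_poly_det1 (R : comNzRingType) (A : 'M[R]_2) :
  \det A = 1 -> char_poly A = 'X^2 - \tr A *: 'X + 1.
Proof.
move=> detA; have sz := size_char_poly A; have /monicP := char_poly_monic A.
rewrite /lead_coef sz /= => c2; have c1 := char_poly_trace A isT.
have c0 := char_poly_det A; rewrite detA expr2 mulrNN !mul1r in c0.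
move: (char_poly A) sz c2 c1 c0 => g sz c2 c1 c0.
apply/polyP => -[|[|[|i]]]; rewrite !coefE ?c0 ?c1 ?c2 /=.
- by rewrite mulr0 subr0 add0r.
- by rewrite mulr1 add0r addr0.
- by rewrite mulr0 subr0 addr0.
by rewrite mulr0 subr0 addr0 nth_default // sz.
Qed.

Lemma det1_horner_mx_eq0 (F : fieldType) (A : 'M[F]_2) (g : {poly F}) :
  \det A = 1 -> 'X^2 - \tr A *: 'X + 1 %| g -> horner_mx A g = 0.
Proof.
move=> /char_poly_det1 <- /dvdpP[h ->].
by rewrite rmorphM /= Cayley_Hamilton mulr0.
Qed.

Lemma det1_sqr_mx (F : fieldType) (A : 'M[F]_2) :
  \det A = 1 -> A ^+ 2 = \tr A *: A - 1.
Proof.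
move=> detA; have := det1_horner_mx_eq0 detA (dvdpp _).
rewrite rmorphD rmorphB rmorph1 /= horner_mxZ horner_mx_X rmorphXn /= horner_mx_X.
by move/eqP; rewrite addr_eq0 subr_eq => /eqP->; rewrite addrC.
Qed.

Lemma GLvalX n (R : finComUnitRingType) (g : {'GL_n[R]}) k :
  GLval (g ^+ k)%g = GLval g ^+ k.
Proof. by elim: k => [|k IHk]; rewrite ?expg0 // expgS exprS -IHk. Qed.

Lemma spectrum_dvdn (gT : finGroupType) (G : {group gT}) x k :
  x \in G -> (k %| #[x]%g)%N -> k \in spectrum G.
Proof.
move=> Gx dv_k; apply/existsP; exists (x ^+ (#[x] %/ k))%g; rewrite groupX //=.
by rewrite orderXdiv ?dvdn_div // divnA // mulKn.
Qed.

(** * Element orders in [SL2] and [PSL2] *)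

Section SpecialLinear.

Variable F : finFieldType.
Let q := #|F|.

(* The order of [{1, -1}], which is [gcd 2 (q - 1)]. *)
Definition sign_order := if 2%:R == 0 :> F then 1%N else 2%N.
Local Notation d := sign_order.

Lemma expr_sign_order (x : F) : x ^+ 2 = 1 -> x ^+ d = 1.
Proof.
rewrite /d; case: eqP => // two0 /eqP; rewrite sqrf_eq1 => /orP[] /eqP-> //.
by apply/eqP; rewrite expr1 -subr_eq0 -opprD oppr_eq0 -[1 + 1]/(2%:R) two0.
Qed.

Lemma exists_SL2 (A : 'M[F]_2) : \det A = 1 -> exists2 g, g \in SL2 F & GLval g = A.
Proof.
move=> detA; have Aunit : A \is a GRing.unit by rewrite unitmxE detA unitr1.
by exists (FinRing.unit _ Aunit); rewrite ?inE ?detA.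
Qed.

(** Phrasing centrality as a power relation turns orders in [PSL2] into divisibility of orders in
    [SL2]. A central [g] commutes with the transvections [1 + E_ij], hence with [E_01] and [E_10],
    so it is a scalar of square 1. Conversely, if [2 != 0] and [g ^+ 2 = 1], Cayley-Hamilton gives
    [tr(g) g = 2], so the trace is nonzero and [g] is scalar. *)
Lemma center_SL2 g : g \in SL2 F -> (g \in 'Z(SL2 F))%g = (g ^+ d == 1)%g.
Proof.
move=> SLg; have detg : \det (GLval g) = 1 by apply/eqP; rewrite inE in SLg.
have scal_cent x : GLval g = x%:M -> g \in ('Z(SL2 F))%g.
  move=> def_g; apply/centerP; split=> // h _; apply: val_inj.
  by change (GLval g *m GLval h = GLval h *m GLval g); rewrite def_g scalar_mxC.
apply/idP/eqP => [/centerP[_ cent_g] | gd1].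
  have cent_det1 (B : 'M_2) : \det B = 1 -> GLval g *m B = B *m GLval g.
    by case/exists_SL2=> h SLh <-; have /(congr1 val) := cent_g h SLh.
  have cent_delta i j : i != j -> GLval g *m delta_mx i j = delta_mx i j *m GLval g.
    move=> neq_ij; have: \det (1%:M + delta_mx i j : 'M[F]_2) = 1.
      move: i j neq_ij => [[|[|//]] ?] [[|[|//]] ?] // _.
        by rewrite det_mx22 !mxE /= !(addr0, mulr0, subr0) mulr1.
      by rewrite det_mx22 !mxE /= !(addr0, mul0r, subr0) mulr1.
    by move/cent_det1; rewrite mulmxDr mulmxDl mulmx1 mul1mx => /addrI.
  pose simp01 := (mulr0, mul0r, mulr1, mul1r, addr0, add0r).
  have /matrixP c01 := cent_delta 0 1 isT; have /matrixP c10 := cent_delta 1 0 isT.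
  have g10 : GLval g 1 0 = 0.
    by move: (c01 0 0); rewrite !mxE !sum_ord2 !mxE /= !simp01 => <-.
  have g01 : GLval g 0 1 = 0.
    by move: (c10 0 0); rewrite !mxE !sum_ord2 !mxE /= !simp01 => ->.
  have g11 : GLval g 1 1 = GLval g 0 0.
    by move: (c01 0 1); rewrite !mxE !sum_ord2 !mxE /= !simp01 => ->.
  have def_g : GLval g = (GLval g 0 0)%:M.
    apply/matrixP=> i j; rewrite mxE.
    by case: (ord2P i) => ->; case: (ord2P j) => ->; rewrite ?mulr1n ?mulr0n.
  apply: val_inj; rewrite /= GLvalX def_g -rmorphXn /=.
  by rewrite expr_sign_order // -detg det_mx22 g11 g01 mul0r subr0.
move: gd1; rewrite /d; case: eqP => [_|/eqP two_neq0 g2].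
  by rewrite expg1 => ->; apply: group1.
have A2 : GLval g ^+ 2 = 1 by rewrite -GLvalX g2.
have /eqP := det1_sqr_mx detg; rewrite A2 eq_sym subr_eq => /eqP trA.
have two_mx : 1 + 1 = (2%:R)%:M :> 'M[F]_2 by rewrite -[1]/(1%:M) -raddfD.
have tr_neq0 : \tr (GLval g) != 0.
  apply: contraNneq two_neq0 => tr0; move: trA; rewrite tr0 scale0r two_mx.
  by move/matrixP/(_ 0 0); rewrite !mxE => /esym/eqP.
apply: (scal_cent ((\tr (GLval g))^-1 * 2%:R)).
by rewrite -scale_scalar_mx -two_mx -trA scalerA mulVf // scale1r.
Qed.

(** By Cayley-Hamilton, [g] satisfies whatever its characteristic polynomial divides, so the three
    cases are those of [dvdp_det1]. In the last one [g ^+ p] is the scalar [x ^+ p], and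
    [x ^+ d = 1]. *)
Lemma SL2_expr p alpha g : prime p -> q = (p ^ alpha)%N -> g \in SL2 F ->
  [\/ g ^+ q.-1 = 1, g ^+ q.+1 = 1 | g ^+ (d * p) = 1]%g.
Proof.
move=> p_pr cardF SLg; have detg : \det (GLval g) = 1 by apply/eqP; rewrite inE in SLg.
have to_g k : GLval g ^+ k = 1 -> (g ^+ k)%g = 1%g.
  by move=> gk; apply: val_inj; rewrite /= GLvalX gk.
have dvd_g k : 'X^2 - \tr (GLval g) *: 'X + 1 %| 'X^k - 1 -> (g ^+ k)%g = 1%g.
  move=> dv; apply: to_g; have := det1_horner_mx_eq0 detg dv.
  by rewrite rmorphB rmorph1 rmorphXn /= horner_mx_X => /eqP; rewrite subr_eq0 => /eqP.
case: (dvdp_det1 (\tr (GLval g)) p_pr cardF) => [/dvd_g|/dvd_g|[x x2 dv]].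
- by constructor 1.
- by constructor 2.
constructor 3; apply: to_g; have := det1_horner_mx_eq0 detg dv.
rewrite rmorphB rmorphXn /= horner_mx_X horner_mx_C => /eqP; rewrite subr_eq0 => /eqP gp.
by rewrite mulnC exprM gp -rmorphXn /= -exprM mulnC exprM expr_sign_order ?expr1n.
Qed.

(* The companion matrix of ['X^2 - t *: 'X + 1] has the eigenvalue [s]. *)
Lemma SL2_order_of_eigenvalue (L : fieldType) (f : {rmorphism F -> L}) s t k :
    s != 0 -> f t = s + s^-1 -> (forall j, s ^+ j = 1 -> (k %| j)%N) ->
  exists2 g, g \in SL2 F & (k %| #[g]%g)%N.
Proof.
move=> s_neq0 def_t ord_s.
pose A : 'M[F]_2 :=
  \matrix_(i, j) if i == 0 then (j == 1)%:R else if j == 0 then -1 else t.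
have detA : \det A = 1 by rewrite det_mx22 !mxE /= mul0r sub0r mul1r opprK.
have [g SLg def_g] := exists_SL2 detA; exists g => //; apply: ord_s.
pose B := map_mx f A.
have detB : \det B = 1 by rewrite det_map_mx detA rmorph1.
have : eigenvalue B s.
  rewrite eigenvalue_root_char char_poly_det1 // /mxtrace sum_ord2 !mxE /=.
  rewrite rmorph0 add0r def_t /root !hornerE.
  by apply/eqP; field.
case/eigenvalueP => v sv v_neq0.
have v_ord : v *m B ^+ #[g]%g = s ^+ #[g]%g *: v.
  elim: (#[g]%g) => [|k' IHk]; first by rewrite expr0 mulmx1 scale1r.
  by rewrite exprSr mulmxA IHk -scalemxAl sv scalerA exprSr.
have B1 : B ^+ #[g]%g = 1.
  have A1 : A ^+ #[g]%g = 1 by have := GLvalX g #[g]%g; rewrite def_g expg_order => /esym.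
  by rewrite -(rmorphXn (map_mx f)) /= A1 rmorph1.
move: v_ord; rewrite B1 mulmx1 -{1}[v]scale1r => /esym.
by move/eqP; rewrite -subr_eq0 -scalerBl scaler_eq0 (negPf v_neq0) orbF subr_eq0 => /eqP.
Qed.

(** The eigenvalue is a generator of the cyclic group of units of [F]. *)
Lemma SL2_split_torus : exists2 g, g \in SL2 F & (q.-1 %| #[g]%g)%N.
Proof.
have /cyclicP[x def_U] := field_unit_group_cyclic [set: {unit F}].
apply: (@SL2_order_of_eigenvalue F idfun (val x) (val x + (val x)^-1)) => // [|j xj].
  by rewrite -unitfE (valP x).
rewrite -card_finField_unit def_U -orderE order_dvdn; apply/eqP/val_inj.
by rewrite FinRing.val_unitX.
Qed.

(** The eigenvalue [s] is a primitive root of unity of order [q + 1] in a splitting field of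
    [X^(q+1) - 1], which is separable because [q + 1 = 1] there. As [s ^+ q = s^-1], the trace
    [s + s^-1] is fixed by the [q]-th power map and so lies in [F]. *)
Lemma SL2_nonsplit_torus p alpha : prime p -> q = (p ^ alpha)%N ->
  exists2 g, g \in SL2 F & (q.+1 %| #[g]%g)%N.
Proof.
move=> p_pr cardF; have pcharF := card_finPcharP cardF p_pr.
have alpha_gt0 : (0 < alpha)%N.
  by have := finNzRing_gt1 F; rewrite -/q cardF; case: (alpha).
pose P : {poly F} := 'X^(q.+1) - 1.
have P_neq0 : P != 0 by rewrite -size_poly_gt0 size_XnsubC.
have [L [rs def_P _]] := FinSplittingFieldFor P_neq0.
have pcharL : p \in [pchar L] by rewrite pchar_lalg.
rewrite rmorphB rmorphXn rmorph1 /= map_polyX in def_P.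
have q1L : q.+1%:R != 0 :> L.
  rewrite cardF -(prednK alpha_gt0) expnS -addn1 natrD natrM (pcharf0 pcharL) mul0r add0r.
  exact: oner_neq0.
have uniq_rs : uniq rs.
  by rewrite -separable_prod_XsubC -(eqp_separable def_P) separable_Xn_sub_1.
have all_rs : all q.+1.-unity_root rs.
  apply/allP=> z; rewrite -root_prod_XsubC -(eqp_root def_P) /root !hornerE subr_eq0.
  by rewrite unity_rootE.
have size_rs : (q.+1 <= size rs)%N.
  by have := eqp_size def_P; rewrite size_XnsubC // size_prod_XsubC => -[<-].
have /hasP[s _ prim_s] := has_prim_root (ltn0Sn q) all_rs uniq_rs size_rs.
have s_neq0 : s != 0.
  have := prim_expr_order prim_s; apply: contra_eq_neq => ->.
  by rewrite expr0n eq_sym oner_neq0.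
have s_q : s ^+ q = s^-1.
  by apply: (mulfI s_neq0); rewrite -exprS (prim_expr_order prim_s) mulfV.
have [t def_t] : exists t : F, in_alg L t = s + s^-1.
  have : s + s^-1 \in 1%VS.
    rewrite -[1%VS]/(asval 1%AS) (Fermat's_little_theorem 1%AS).
    have pnat_q : [pchar L].-nat q by rewrite cardF pnatX pnatE // pcharL.
    by rewrite dimv1 expn1 exprDn_pchar // exprVn s_q invrK addrC.
  by case/vlineP => t ->; exists t.
apply: (SL2_order_of_eigenvalue s_neq0 def_t) => j.
by rewrite (prim_order_dvd prim_s) => ->.
Qed.

Local Notation Z := ('Z(SL2 F))%g.

Lemma PSL2_order_dvd g k : g \in SL2 F ->
  (#[coset Z g]%g %| k)%N = (#[g]%g %| d * k)%N.
Proof.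
move=> SLg; have Ng : g \in ('N(Z))%g by apply: subsetP SLg; apply: gFnorm.
have SLgk : (g ^+ k)%g \in SL2 F by rewrite groupX.
rewrite !order_dvdn -morphX // mulnC expgM -center_SL2 //.
by apply/eqP/idP => [/coset_idr|/coset_id //]; apply; rewrite groupX.
Qed.

Lemma spectrum_PSL2_dvd g k : g \in SL2 F -> (k * d %| #[g]%g)%N ->
  k \in spectrum (PSL2 F).
Proof.
move=> SLg dv_k; have xP : coset Z g \in PSL2 F by apply: mem_quotient.
have dv_kx : (k %| #[coset Z g]%g)%N.
  have := dvdnn #[coset Z g]%g; rewrite PSL2_order_dvd // => /(dvdn_trans dv_k).
  by rewrite mulnC dvdn_pmul2l // /d; case: ifP.
exact: spectrum_dvdn xP dv_kx.
Qed.

Lemma spectrum_PSL2_cases p alpha m n k : prime p -> q = (p ^ alpha)%N ->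
    q.-1 = (m * d)%N -> q.+1 = (n * d)%N -> k \in spectrum (PSL2 F) ->
  [|| k %| m, k %| n | k == p]%N.
Proof.
move=> p_pr cardF def_m def_n /existsP[_ /andP[/morphimP[g _ SLg ->] /eqP <-]].
rewrite !PSL2_order_dvd // ![(d * _)%N]mulnC -def_m -def_n !order_dvdn.
case: (SL2_expr p_pr cardF SLg) => [->|->|gdp]; rewrite ?eqxx ?orbT //.
have: (#[coset Z g]%g %| p)%N by rewrite PSL2_order_dvd // order_dvdn gdp.
(* The image has order 1 or [p]; order 1 is counted among the divisors of [m]. *)
case/primeP: p_pr => _ /[apply] /orP[/eqP o1|->]; last by rewrite !orbT.
have : (#[coset Z g]%g %| m)%N by rewrite o1 dvd1n.
by rewrite PSL2_order_dvd // mulnC -def_m order_dvdn => ->.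
Qed.

End SpecialLinear.

(** * Spectra of direct products, and the conclusion *)

Section ProductSpectrum.

Variables gT hT : finGroupType.

Lemma order_pair (a : gT) (b : hT) : #[(a, b)]%g = lcmn #[a]%g #[b]%g.
Proof.
have pairX k : ((a, b) ^+ k)%g = (a ^+ k, b ^+ k)%g.
  by elim: k => // k IHk; rewrite !expgS IHk.
apply/eqP; rewrite eqn_dvd order_dvdn pairX dvdn_lcm !order_dvdn.
have /eqP := expg_order (a, b); rewrite pairX !xpair_eqE => /andP[-> ->].
by rewrite -!order_dvdn dvdn_lcml dvdn_lcmr.
Qed.

Lemma spectrum_setX (G : {group gT}) (H : {group hT}) k :
  reflect (exists a b, [/\ a \in spectrum G, b \in spectrum H & k = lcmn a b])
          (k \in spectrum (setX_group G H)).
Proof.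
apply: (iffP existsP) => [[[x y] /andP[]] | [a [b []]]].
  rewrite inE /= => /andP[Gx Hy] /eqP <-; exists #[x]%g, #[y]%g.
  by split; rewrite ?order_pair //; apply/existsP; [exists x | exists y]; rewrite ?Gx ?Hy /=.
case/existsP=> x /andP[Gx /eqP <-] /existsP[y /andP[Hy /eqP <-]] ->.
by exists (x, y); rewrite inE /= Gx Hy order_pair /=.
Qed.

End ProductSpectrum.

(* Two orders outside the spectrum of [K] are both [p], and [lcm(p, p) = p]. *)
Lemma isospectral_setX_square (gT hT : finGroupType) (G : {group gT})
    (K : {group hT}) p :
    {subset spectrum K <= spectrum G} ->
    (forall k, k \in spectrum G -> k \in spectrum K \/ k = p) ->
  isospectral (setX_group G K) (setX_group G G).
Proof.
move=> sKG GKp k; have K1 : 1%N \in spectrum K.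
  by apply/existsP; exists 1%g; rewrite group1 order1.
apply/spectrum_setX/spectrum_setX=> -[a [b [Ga Kb ->]]].
  by exists a, b; split=> //; apply: sKG.
case: (GKp b Kb) => [Kb'|def_b]; first by exists a, b.
case: (GKp a Ga) => [Ka|def_a]; first by exists b, a; rewrite lcmnC.
exists a, 1%N; split=> //; rewrite lcmn1 def_a def_b.
exact/lcmn_idPr/dvdnn.
Qed.

(** For odd [q] the two numbers are consecutive integers; for even [q] they are odd and differ by 2.
    The bound [3 < q] gives [1 < m], so that [Z/m] is a nonzero ring; [q = 3] would give [m = 1]. *)
Lemma sign_order_torus_orders (F : finFieldType) p alpha (q := #|F|) :
    prime p -> q = (p ^ alpha)%N -> (3 < q)%N ->
  exists m n, [/\ q.-1 = (m * sign_order F)%N, q.+1 = (n * sign_order F)%N,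
                  coprime m n, (1 < m)%N & (0 < n)%N].
Proof.
move=> p_pr cardF q_gt3.
have pcharF := card_finPcharP cardF p_pr.
have alpha_gt0 : (0 < alpha)%N by move: q_gt3; rewrite cardF; case: (alpha).
have odd_q : odd q = (2%:R != 0 :> F).
  rewrite -(dvdn_pcharf pcharF) cardF oddX eqn0Ngt alpha_gt0 /= dvdn_prime2 //.
  by case: (even_prime p_pr) => [->|odd_p] //; rewrite odd_p; case: eqP odd_p => // ->.
clear cardF; clearbody q; case: q q_gt3 odd_q => // k k_gt2.
rewrite /sign_order -if_neg /= => odd_k.
case: ifP odd_k => _ odd_k.
  exists k./2, k./2.+1; have def_k : k = (k./2 * 2)%N.
    by rewrite muln2 halfK (negPf (_ : ~~ odd k)) ?subn0.
  split; rewrite ?coprimenS //; first by rewrite {1}def_k mulSn.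
  by rewrite -(ltn_pmul2r (isT : 0 < 2)%N) -def_k.
exists k, k.+2; rewrite !muln1; split=> //; last exact: ltnW.
by rewrite /coprime -add2n gcdnDr -/(coprime k 2) coprimen2 -[odd k]negbK odd_k.
Qed.

Local Close Scope ring_scope.

Theorem proposition3p4 (p alpha : nat) (F : finFieldType)
    (p_prime : prime p) (q_ge4 : 4 <= p ^ alpha) (cardF : #|F| = p ^ alpha) :
  unrecognizable (setX_group (PSL2 F) (PSL2 F)).
Proof.
have q_gt3 : (3 < #|F|)%N by rewrite cardF.
have [m [n [def_m def_n co_mn m_gt1 n_gt0]]] :=
  sign_order_torus_orders p_prime cardF q_gt3.
have [R [u [un1 u_free charR]]] := exists_free_root_of_unity m_gt1 n_gt0 co_mn.
pose K i := affine_group i n_gt0 un1.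
exists (fun i => _), (fun i => setX_group (PSL2 F) (K i)); split=> [i | i j neq_ij].
  (* The two tori of [SL2] provide, modulo the center, all divisors of [m] and of [n]; this puts the
     spectrum of [K i] inside that of [PSL2 F]. *)
  have [g SLg dv_g] := SL2_split_torus F.
  have [h SLh dv_h] := SL2_nonsplit_torus p_prime cardF.
  apply: (isospectral_setX_square (p := p)) => k.
    case/existsP=> x /andP[Kx /eqP <-].
    case/orP: (affine_order_dvd u_free charR Kx) => dv.
      by apply: (spectrum_PSL2_dvd SLg); apply: dvdn_trans dv_g; rewrite def_m dvdn_mul.
    by apply: (spectrum_PSL2_dvd SLh); apply: dvdn_trans dv_h; rewrite def_n dvdn_mul.
  move=> Lk; case/or3P: (spectrum_PSL2_cases p_prime cardF def_m def_n Lk) => [dv|dv|/eqP].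
  - left; have [x Kx dv_x] := affine_has_order_m i n_gt0 un1 charR.
    exact: (spectrum_dvdn (G := K i) Kx (dvdn_trans dv dv_x)).
  - left; have [x Kx dv_x] := affine_has_order_n i n_gt0 un1 u_free.
    exact: (spectrum_dvdn (G := K i) Kx (dvdn_trans dv dv_x)).
  by right.
(* The groups are told apart by their orders: [K i] has order [n * #|R| ^ i.+1], and [#|R| > 1]. *)
apply: contra neq_ij => /card_isog/eqP.
rewrite /= !cardsX !(card_affine_set _ un1 u_free).
by rewrite !eqn_pmul2l ?cardG_gt0 // eqn_exp2l ?finNzRing_gt1.
Qed.
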